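(* Let $(X^{(0)},y^{(0)},S^{(0)})$ be a strictly feasible solution of the primal-dual SDO pair (P)-(D) and let $\epsilon<1$. At each iteration $k$ of the iterative refinement algorithm with oracle precision $\epsilon$, the iterates satisfy $$X^{(k+1)}\bullet S^{(k+1)}\le\epsilon\left(X^{(k)}\bullet S^{(k)}\right)^2 .$$
   Context: $\mathcal S^n$ is the space of real symmetric $n\times n$ matrices, $U\bullet V=\mathrm{tr}(UV)$, and $\succeq,\succ$ denote the Löwner order. Data: $b\in\mathbb R^m$, $C,A_1,\dots,A_m\in\mathcal S^n$ with $A_1,\dots,A_m$ linearly independent. (P): $\inf_X\{C\bullet X: A_i\bullet X=b_i\ (i=1,\dots,m),\ X\succeq0\}$. (D): $\sup_{y,S}\{b^\top y:\sum_i y_iA_i+S=C,\ S\succeq0,\ y\in\mathbb R^m\}$. ''Strictly feasible'' means feasible with $X\succ0$, $S\succ0$. Refining problems for a current solution $(X,y,S)$ and scaling factor $\eta\ge1$: $(\bar P)$: $\min_{\bar X\in\mathcal S^n}\{\eta S\bullet\bar X: A_i\bullet\bar X=0\ (i=1,\dots,m),\ \bar X\succeq-\eta X\}$; $(\bar D)$: $\max_{\bar y\in\mathbb R^m,\bar S\in\mathcal S^n}\{-\eta X\bullet\bar S:\sum_i\bar y_iA_i+\bar S=\eta S,\ \bar S\succeq0\}$. Oracle: given (P)-(D) or a refining pair, it returns an interior feasible solution with duality gap at most $\epsilon$ (for (P)-(D) the gap is $X\bullet S$; for the refining pair it is $(\eta X+\bar X)\bullet\bar S$). Iterative refinement algorithm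 (tolerances $0<\tilde\epsilon\ll\epsilon<1$): let $(X^{(1)},y^{(1)},S^{(1)})$ be the oracle's solution of (P)-(D) to precision $\epsilon$ and $\eta^{(1)}=1/(X^{(1)}\bullet S^{(1)})$. For $k=1,2,\dots$, while $X^{(k)}\bullet S^{(k)}>\tilde\epsilon$: let $(\bar X,\bar y,\bar S)$ be the oracle's solution to precision $\epsilon$ of the refining pair with $X=X^{(k)}$, $S=S^{(k)}$, $\eta=\eta^{(k)}$; set $X^{(k+1)}=X^{(k)}+\frac1{\eta^{(k)}}\bar X$, $y^{(k+1)}=y^{(k)}+\frac1{\eta^{(k)}}\bar y$, $S^{(k+1)}=C-\sum_iy_i^{(k+1)}A_i$, and $\eta^{(k+1)}=1/(X^{(k+1)}\bullet S^{(k+1)})$. *)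

(* Defs.v *)
From HB Require Import structures.
From mathcomp Require Import all_boot all_order all_algebra.
From mathcomp Require Import reals.
Set Implicit Arguments.
Unset Strict Implicit.
Unset Printing Implicit Defensive.
Import Order.TTheory GRing.Theory Num.Theory.
Local Open Scope ring_scope.

Definition mxdot (R : realType) (n : nat) (U V : 'M[R]_n) : R := \tr (U *m V).
Notation "U • V" := (mxdot U V) (at level 40, no associativity) : ring_scope.

(* Symmetry is part of both predicates: the Löwner order lives on S^n. *)
Definition psd (R : realType) (n : nat) (U : 'M[R]_n) : Prop :=
  U \is symmetricmx /\ forall x : 'cV[R]_n, 0 <= (x^T *m U *m x) 0 0.
Definition pd (R : realType) (n : nat) (U : 'M[R]_n) : Prop :=
  U \is symmetricmx /\
  forall x : 'cV[R]_n, x != 0 -> 0 < (x^T *m U *m x) 0 0.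

Notation "U ⪰ V" := (psd (U - V)) (at level 70, no associativity) : ring_scope.
Notation "U ≻ V" := (pd (U - V)) (at level 70, no associativity) : ring_scope.

Record sdo (R : realType) (m n : nat) := Sdo {
  sdo_b : 'cV[R]_m;
  sdo_C : 'M[R]_n;
  sdo_A : m.-tuple 'M[R]_n;
  sdo_C_sym : sdo_C \is symmetricmx;
  sdo_A_sym : forall i, tnth sdo_A i \is symmetricmx;
  sdo_A_free : free sdo_A }.

Section Problems.
Variables (R : realType) (m n : nat) (Q : sdo R m n).

Local Notation A i := (tnth (sdo_A Q) i).
Local Notation b := (sdo_b Q).
Local Notation C := (sdo_C Q).

Definition lincomb (y : 'cV[R]_m) : 'M[R]_n := \sum_(i < m) y i 0 *: A i.

(* The pair is: minimize P_obj over P_feasible, maximize D_obj over D_feasible. *)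
Definition P_obj (X : 'M[R]_n) : R := C • X.
Definition P_feasible (X : 'M[R]_n) : Prop :=
  (forall i : 'I_m, A i • X = b i 0) /\ X ⪰ 0.
Definition D_obj (y : 'cV[R]_m) : R := \sum_(i < m) b i 0 * y i 0.
Definition D_feasible (y : 'cV[R]_m) (S : 'M[R]_n) : Prop :=
  lincomb y + S = C /\ S ⪰ 0.

Definition strictly_feasible (X : 'M[R]_n) (y : 'cV[R]_m) (S : 'M[R]_n) : Prop :=
  [/\ P_feasible X, D_feasible y S, X ≻ 0 & S ≻ 0].

(* The refining pair is: minimize refP_obj, maximize refD_obj; the current
   solution X, S and the scaling factor eta are data, Xb, yb, Sb variables. *)
Definition refP_obj (S : 'M[R]_n) (eta : R) (Xb : 'M[R]_n) : R :=
  (eta *: S) • Xb.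
Definition refP_feasible (X : 'M[R]_n) (eta : R) (Xb : 'M[R]_n) : Prop :=
  [/\ Xb \is symmetricmx, forall i : 'I_m, A i • Xb = 0 & Xb ⪰ - (eta *: X)].
Definition refD_obj (X : 'M[R]_n) (eta : R) (Sb : 'M[R]_n) : R :=
  - ((eta *: X) • Sb).
Definition refD_feasible (S : 'M[R]_n) (eta : R)
    (yb : 'cV[R]_m) (Sb : 'M[R]_n) : Prop :=
  lincomb yb + Sb = eta *: S /\ Sb ⪰ 0.

(* The oracle is nondeterministic: the next two predicates describe all the
   answers it may give to a query with precision eps.  The duality gaps are
   the expressions X • S and (eta X + Xb) • Sb; [gapE] and [ref_gapE] relate
   them to the objectives. *)
Definition oracle_answer (eps : R)
    (X : 'M[R]_n) (y : 'cV[R]_m) (S : 'M[R]_n) : Prop :=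
  strictly_feasible X y S /\ X • S <= eps.

Definition oracle_ref_answer (eps : R) (X S : 'M[R]_n) (eta : R)
    (Xb : 'M[R]_n) (yb : 'cV[R]_m) (Sb : 'M[R]_n) : Prop :=
  [/\ refP_feasible X eta Xb, refD_feasible S eta yb Sb,
      Xb ≻ - (eta *: X), Sb ≻ 0
    & (eta *: X + Xb) • Sb <= eps].

Definition refinement_step (eps : R)
    (X : 'M[R]_n) (y : 'cV[R]_m) (S : 'M[R]_n) (eta : R)
    (X' : 'M[R]_n) (y' : 'cV[R]_m) (S' : 'M[R]_n) (eta' : R) : Prop :=
  exists (Xb : 'M[R]_n) (yb : 'cV[R]_m) (Sb : 'M[R]_n),
    oracle_ref_answer eps X S eta Xb yb Sb /\
    [/\ X' = X + eta^-1 *: Xb, y' = y + eta^-1 *: yb,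
        S' = C - lincomb y' & eta' = (X' • S')^-1].

(* Iteration k (counted from 1) of the while loop is executed. *)
Definition executed (teps : R) (X S : nat -> 'M[R]_n) (k : nat) : Prop :=
  (1 <= k)%N /\ forall j : nat, (1 <= j <= k)%N -> teps < X j • S j.

(* A run of the algorithm.  The entries beyond the last iterate produced
   before termination are unconstrained, and so are those of index 0. *)
Definition refinement_run (eps teps : R) (X : nat -> 'M[R]_n)
    (y : nat -> 'cV[R]_m) (S : nat -> 'M[R]_n) (eta : nat -> R) : Prop :=
  [/\ oracle_answer eps (X 1%N) (y 1%N) (S 1%N),
      eta 1%N = (X 1%N • S 1%N)^-1
    & forall k : nat, executed teps X S k ->
        refinement_step eps (X k) (y k) (S k) (eta k)
          (X k.+1) (y k.+1) (S k.+1) (eta k.+1)].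

Lemma lincomb_dot y X : lincomb y • X = \sum_(i < m) y i 0 * (A i • X).
Proof.
rewrite /mxdot /lincomb mulmx_suml raddf_sum /=.
by apply: eq_bigr => i _; rewrite -scalemxAl mxtraceZ.
Qed.

Lemma gapE X y S : P_feasible X -> D_feasible y S ->
  P_obj X - D_obj y = X • S.
Proof.
move=> [AX _] [yS _]; rewrite /P_obj /D_obj -yS.
have -> : \sum_(i < m) b i 0 * y i 0 = lincomb y • X.
  by rewrite lincomb_dot; apply: eq_bigr => i _; rewrite AX mulrC.
by rewrite /mxdot mulmxDl raddfD /= addrC addKr mxtrace_mulC.
Qed.

Lemma ref_gapE X S eta Xb yb Sb :
  refP_feasible X eta Xb -> refD_feasible S eta yb Sb ->
  refP_obj S eta Xb - refD_obj X eta Sb = (eta *: X + Xb) • Sb.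
Proof.
move=> [_ AX _] [yS _]; rewrite /refP_obj /refD_obj -yS opprK.
have y0 : lincomb yb • Xb = 0.
  by rewrite lincomb_dot big1 // => i _; rewrite AX mulr0.
move: y0; rewrite /mxdot !mulmxDl !raddfD /= => ->.
by rewrite add0r addrC [\tr (Sb *m Xb)]mxtrace_mulC.
Qed.

End Problems.

(* Main.v *)
Require Import Defs.
From HB Require Import structures.
From mathcomp Require Import all_boot all_order all_algebra.
From mathcomp Require Import reals.
Import Order.TTheory GRing.Theory Num.Theory.
Local Open Scope ring_scope.

(** The refining pair is a rescaled copy of (P)-(D), recentred at the current
    solution.  On the primal side [eta X' = eta X + Xb] by the update of [X].
    On the dual side, the constraint [lincomb yb + Sb = eta S] says that the
    slack recomputed from the new multipliers is [S' = eta^-1 Sb]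
    ([refined_slackE]).  So the new gap [X' • S'] is exactly [eta^-2] times the
    gap of the refining pair ([refined_gapE]), which the oracle keeps below
    [eps]; as [eta^-1] is the current gap [X • S], the bound is
    [eps * (X • S) ^+ 2].

    This uses two facts about the current iterate, [S = C - lincomb y] and
    [eta = (X • S)^-1].  Both hold along the whole run ([run_invariant]): at
    the first iterate by dual feasibility and the choice of the first scaling
    factor, later by the update rules.
    Inverting [eta] is legitimate because the loop only runs while the gap
    exceeds [teps], hence is positive. *)

Lemma lincombD (R : realType) (m n : nat) (Q : sdo R m n) (y z : 'cV[R]_m) :
  lincomb Q (y + z) = lincomb Q y + lincomb Q z.
Proof.
by rewrite /lincomb -big_split; apply: eq_bigr => i _; rewrite mxE scalerDl.
Qed.

Lemma lincombZ (R : realType) (m n : nat) (Q : sdo R m n) (a : R)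
    (y : 'cV[R]_m) :
  lincomb Q (a *: y) = a *: lincomb Q y.
Proof.
by rewrite /lincomb scaler_sumr; apply: eq_bigr => i _; rewrite mxE scalerA.
Qed.

Lemma mxdotZ (R : realType) (n : nat) (a c : R) (U V : 'M[R]_n) :
  (a *: U) • (c *: V) = a * c * (U • V).
Proof. by rewrite /mxdot -scalemxAl -scalemxAr !mxtraceZ mulrA. Qed.

(** The current slack cancels: [S - eta^-1 (eta S - Sb)] leaves only the
    rescaled slack of the refining problem. *)
Lemma refined_slackE (R : realType) (m n : nat) (Q : sdo R m n)
    (y yb : 'cV[R]_m) (S Sb : 'M[R]_n) (eta : R) :
  eta != 0 -> lincomb Q y + S = sdo_C Q -> lincomb Q yb + Sb = eta *: S ->
  sdo_C Q - lincomb Q (y + eta^-1 *: yb) = eta^-1 *: Sb.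
Proof.
move=> eta_neq0 yS ybSb.
have defSb : Sb = eta *: S - lincomb Q yb by rewrite -ybSb addrC addKr.
rewrite lincombD lincombZ -yS defSb scalerBr scalerA mulVf // scale1r.
by rewrite opprD addrA [lincomb Q y + S]addrC addrK.
Qed.

Lemma refined_gapE (R : realType) (n : nat) (X Xb Sb : 'M[R]_n) (eta : R) :
  eta != 0 ->
  (X + eta^-1 *: Xb) • (eta^-1 *: Sb) =
    eta^-1 ^+ 2 * ((eta *: X + Xb) • Sb).
Proof.
move=> eta_neq0.
have -> : X + eta^-1 *: Xb = eta^-1 *: (eta *: X + Xb).
  by rewrite scalerDr scalerA mulVf // scale1r.
by rewrite mxdotZ expr2.
Qed.

(** The update sets [S] and [eta] from the new [X] and [y] by exactly these
    formulas, so both equations are created afresh at each step: distinguishing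
    the first iterate from the later ones replaces an induction. *)
Lemma run_invariant (R : realType) (m n : nat) (Q : sdo R m n) (eps teps : R)
    (X : nat -> 'M[R]_n) (y : nat -> 'cV[R]_m) (S : nat -> 'M[R]_n)
    (eta : nat -> R) :
  refinement_run Q eps teps X y S eta ->
  forall k : nat, executed teps X S k ->
    lincomb Q (y k) + S k = sdo_C Q /\ eta k = (X k • S k)^-1.
Proof.
move=> [[[_ [yS _] _ _] _] eta1 step] [|[|k]] [// k_gt0 gap_gt].
have [|Xb [yb [Sb [_ [_ _ -> ->]]]]] := step k.+1.
  by split=> // j /andP[j_gt0 lejk]; apply: gap_gt; rewrite j_gt0 ltnW.
by split=> //; rewrite addrC subrK.
Qed.

Theorem theorem2 (R : realType) (m n : nat) (Q : sdo R m n) (eps teps : R)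
    (X : nat -> 'M[R]_n) (y : nat -> 'cV[R]_m) (S : nat -> 'M[R]_n)
    (eta : nat -> R)
    (teps_gt0 : 0 < teps) (teps_lt_eps : teps < eps) (eps_lt1 : eps < 1)
    (init : strictly_feasible Q (X 0%N) (y 0%N) (S 0%N))
    (run : refinement_run Q eps teps X y S eta) :
  forall k : nat, executed teps X S k ->
    X k.+1 • S k.+1 <= eps * (X k • S k) ^+ 2.
Proof.
move=> k exec_k; have /run_invariant/(_ k exec_k)[yS etaE] := run.
have [k_gt0 gap_gt] := exec_k.
have gap_gt0 : 0 < X k • S k.
  by apply: lt_trans teps_gt0 (gap_gt k _); rewrite k_gt0 leqnn.
have eta_neq0 : eta k != 0 by rewrite etaE invr_eq0 gt_eqF.
have [_ _ /(_ k exec_k)] := run.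
move=> [Xb [yb [Sb [[_ [ybSb _] _ _ gap_le] [-> defy -> _]]]]].
rewrite defy (refined_slackE _ _ _ _ _ _ _ _ _ eta_neq0 yS ybSb).
rewrite refined_gapE // {1}etaE invrK mulrC.
by rewrite ler_wpM2r // sqr_ge0.
Qed.
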